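(* Let $I\ge 2$, $\mathcal I=\{1,\dots,I\}$, $N\ge 1$, let $\bar a_k,\bar b_{ik}\in\mathbb R$ and $q_{ik},q_{iN},r_{ik},\bar q_{ik},\bar q_{iN},\bar r_{ik}>0$ for $i\in\mathcal I$, $k\in\{0,\dots,N-1\}$. Let $\{\epsilon_k\}_k$ be a zero-mean real random process with $\epsilon_0=0$, and let $x_0$ be a given real random variable independent of $\epsilon$. Consider the scalar system $$x_{k+1}=\bar a_k x_k+\sum_{i\in\mathcal I}\bar b_{ik}u_{ik}+\epsilon_{k+1},\qquad k\in\{0,\dots,N-1\},$$ in which each agent $i\in\mathcal I$ chooses $(u_{ik})_{k=0}^{N-1}$ in order to minimize the expected value of $$L_i(x_0,u)=q_{iN}\,\mathrm{var}(x_N)+\bar q_{iN}\bar x_N^4+\sum_{k=0}^{N-1}\left(q_{ik}\,\mathrm{var}(x_k)+\bar q_{ik}\bar x_k^4+r_{ik}\,\mathrm{var}(u_{ik})+\bar r_{ik}\bar u_{ik}^4\right),$$ where $\bar x_k=\mathbb E[x_k]$ and $\bar u_{ik}=\mathbb E[u_{ik}]$. Define $\alpha_{ik},\bar\alpha_{ik}$ by backward recursion: $\alpha_{iN}=q_{iN}$, $\bar\alpha_{iN}=\bar q_{iN}$ and, for $k=N-1,\dots,0$, $$\bar\alpha_{ik}=\bar q_{ik}+\bar r_{ik}\left((\bar E_k^{-1}\bar c_k)_i\,\bar a_k\right)^4+\bar\alpha_{i,k+1}\left(\bar a_k-\sum_{j\in\mathcal I}(\bar E_k^{-1}\bar c_k)_j\,\bar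 a_k\bar b_{jk}\right)^4,$$ $$\alpha_{ik}=q_{ik}+r_{ik}\left((E_k^{-1}c_k)_i\,\bar a_k\right)^2+\alpha_{i,k+1}\left(\bar a_k-\sum_{j\in\mathcal I}(E_k^{-1}c_k)_j\,\bar a_k\bar b_{jk}\right)^2,$$ where $$c_{ik}=\frac{\alpha_{i,k+1}\bar b_{ik}}{r_{ik}+\alpha_{i,k+1}\bar b_{ik}^2},\qquad \bar c_{ik}=\frac{\left(\frac{\bar\alpha_{i,k+1}\bar b_{ik}}{\bar r_{ik}}\right)^{1/3}}{1+\left(\frac{\bar\alpha_{i,k+1}\bar b_{ik}}{\bar r_{ik}}\right)^{1/3}\bar b_{ik}},$$ $c_k=(c_{ik})_{i\in\mathcal I}$, $\bar c_k=(\bar c_{ik})_{i\in\mathcal I}$, and $E_k,\bar E_k$ are the $I\times I$ matrices with $e_{ii,k}=\bar e_{ii,k}=1$ and, for $j\neq i$, $e_{ij,k}=c_{ik}\bar b_{jk}$, $\bar e_{ij,k}=\bar c_{ik}\bar b_{jk}$. Then the (state-and-mean-field-type feedback Nash) equilibrium strategy of the game is $$u_{ik}^*=-(\bar E_k^{-1}\bar c_k)_i\,(\bar a_k\bar x_k)-(E_k^{-1}c_k)_i\,\bar a_k(x_k-\bar x_k),\qquad i\in\mathcal I,\ k\in\{0,\dots,N-1\}.$$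
   Context: Cube roots are real (odd) roots; $\mathrm{var}$ denotes variance. The control set of each agent at each step is $\mathbb R$; a strategy of agent $i$ is a sequence $(u_{ik})_{k=0}^{N-1}$ of Lebesgue measurable state-and-mean-field-type feedback maps, $u_{ik}=u_{ik}(x_k,\bar x_k)\in\mathbb R$. A profile $(u_i^* )_{i\in\mathcal I}$ of such strategies is a state-and-mean-field-type feedback Nash equilibrium if, for every $i\in\mathcal I$, when all agents $j\neq i$ use the feedback strategies $u_j^*$, the strategy $u_i^*$ minimizes $\mathbb E[L_i(x_0,u)]$ over all strategies of agent $i$.
   Formalization: The noise has zero mean given its past, not just zero mean (otherwise false: N=2, ε₁=ε₂=±1), and strategies are restricted to those whose controls are random variables a.s. equal to a Borel function of the current state. *)

(* Defs.v *)
From HB Require Import structures.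
From mathcomp Require Import all_boot all_order all_algebra.
From mathcomp Require Import all_classical all_reals all_analysis.
From mathcomp Require Import measurable_realfun.

Set Implicit Arguments.
Unset Strict Implicit.
Unset Printing Implicit Defensive.

Import Order.TTheory GRing.Theory Num.Theory.
Import numFieldNormedType.Exports.

Local Open Scope classical_set_scope.
Local Open Scope ring_scope.

Definition cbrt (R : realType) (x : R) : R := Num.sg x * (`|x| `^ 3^-1).

Definition cvec (R : realType) (n : nat) (r alpha b : 'I_n -> R) : 'cV[R]_n :=
  \col_i (alpha i * b i / (r i + alpha i * b i ^+ 2)).

Definition cbarvec (R : realType) (n : nat) (r alpha b : 'I_n -> R) :
    'cV[R]_n :=
  \col_i (cbrt (alpha i * b i / r i) / (1 + cbrt (alpha i * b i / r i) * b i)).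

(* Row i of this matrix carries c_i and the b_j of the other agents; it serves
   both for E_k (with c_k) and for \bar E_k (with \bar c_k). *)
Definition Emx (R : realType) (n : nat) (c : 'cV[R]_n) (b : 'I_n -> R) :
    'M[R]_n :=
  \matrix_(i, j) (if i == j then 1 else c i 0 * b j).

Definition gain (R : realType) (n : nat) (c : 'cV[R]_n) (b : 'I_n -> R)
    (i : 'I_n) : R :=
  (invmx (Emx c b) *m c) i 0.

(* [v k (x, m)] is the control used at step k in state x when E[x_k] = m. *)
Definition feedback (R : realType) := nat -> R * R -> R.

Definition lebesgue_measurable_fun2 (R : realType) (f : R * R -> R) : Prop :=
  forall B : set R, measurable B ->
    completed_algebra_gen (lebesgue_measure \x lebesgue_measure)%E (f @^-1` B).

Definition strategy (R : realType) (N : nat) (v : feedback R) : Prop :=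
  forall k : nat, (k < N)%N -> lebesgue_measurable_fun2 (v k).

(* The junk value of [fine] is harmless: a state or control that is not
   integrable has variance +oo, so the cost below is +oo anyway. *)
Definition mean (d : measure_display) (T : measurableType d) (R : realType)
    (P : probability T R) (X : T -> R) : R := fine 'E_P[X]%E.

Fixpoint state (d : measure_display) (T : measurableType d) (R : realType)
    (P : probability T R) (n : nat) (a : nat -> R) (b : 'I_n -> nat -> R)
    (x0 : T -> R) (eps : nat -> T -> R) (u : 'I_n -> feedback R) (k : nat) :
    T -> R :=
  match k with
  | 0%N => x0
  | k'.+1 => fun w =>
      let x := state P a b x0 eps u k' in
      a k' * x w + \sum_(i < n) b i k' * u i k' (x w, mean P x) + eps k'.+1 w
  end.

Definition control (d : measure_display) (T : measurableType d) (R : realType)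
    (P : probability T R) (n : nat) (a : nat -> R) (b : 'I_n -> nat -> R)
    (x0 : T -> R) (eps : nat -> T -> R) (u : 'I_n -> feedback R)
    (i : 'I_n) (k : nat) : T -> R :=
  fun w => let x := state P a b x0 eps u k in u i k (x w, mean P x).

(* A Lebesgue measurable function of a random variable need not be a random
   variable.  The closed loop makes sense when each control is one and the
   feedback is measurable for the completed law of the current state, i.e. it
   agrees almost surely with a Borel function of that state.  Every profile of
   Borel feedback maps satisfies this. *)
Definition well_posed (d : measure_display) (T : measurableType d)
    (R : realType) (P : probability T R) (n N : nat) (a : nat -> R)
    (b : 'I_n -> nat -> R) (x0 : T -> R) (eps : nat -> T -> R)
    (u : 'I_n -> feedback R) : Prop :=
  forall (i : 'I_n) (k : nat), (k < N)%N ->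
    measurable_fun setT (control P a b x0 eps u i k) /\
    exists g : R -> R, measurable_fun setT g /\
      {ae P, forall w, control P a b x0 eps u i k w
                       = g (state P a b x0 eps u k w)}.

Definition cost (d : measure_display) (T : measurableType d) (R : realType)
    (P : probability T R) (n N : nat) (a : nat -> R) (b : 'I_n -> nat -> R)
    (q qbar r rbar : 'I_n -> nat -> R) (x0 : T -> R) (eps : nat -> T -> R)
    (u : 'I_n -> feedback R) (i : 'I_n) : \bar R :=
  let x := state P a b x0 eps u in
  let v := control P a b x0 eps u i in
  ((q i N)%:E * 'V_P[x N] + (qbar i N * mean P (x N) ^+ 4)%:E
   + \sum_(k < N) ((q i k)%:E * 'V_P[x k] + (qbar i k * mean P (x k) ^+ 4)%:E
                   + (r i k)%:E * 'V_P[v k]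
                   + (rbar i k * mean P (v k) ^+ 4)%:E))%E.

(* The integrand is already deterministic, as L_i only involves means and
   variances. *)
Definition expected_cost (d : measure_display) (T : measurableType d)
    (R : realType) (P : probability T R) (n N : nat) (a : nat -> R)
    (b : 'I_n -> nat -> R) (q qbar r rbar : 'I_n -> nat -> R) (x0 : T -> R)
    (eps : nat -> T -> R) (u : 'I_n -> feedback R) (i : 'I_n) : \bar R :=
  (\int[P]_(w in setT) cost P N a b q qbar r rbar x0 eps u i)%E.

Definition deviate (R : realType) (n : nat) (u : 'I_n -> feedback R)
    (i : 'I_n) (v : feedback R) : 'I_n -> feedback R :=
  fun j => if j == i then v else u j.

Definition feedback_nash (d : measure_display) (T : measurableType d)
    (R : realType) (P : probability T R) (n N : nat) (a : nat -> R)
    (b : 'I_n -> nat -> R) (q qbar r rbar : 'I_n -> nat -> R) (x0 : T -> R)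
    (eps : nat -> T -> R) (u : 'I_n -> feedback R) : Prop :=
  [/\ forall i : 'I_n, strategy N (u i),
      well_posed P N a b x0 eps u &
      forall (i : 'I_n) (v : feedback R), strategy N v ->
        well_posed P N a b x0 eps (deviate u i v) ->
        (expected_cost P N a b q qbar r rbar x0 eps u i <=
         expected_cost P N a b q qbar r rbar x0 eps (deviate u i v) i)%E].

Definition noise_sigma_algebra (T : Type) (R : realType) (eps : nat -> T -> R)
    (J : set nat) : set (set T) :=
  <<s [set eps k @^-1` B | k in J & B in (measurable : set (set R))] >>.

Definition independent_of_noise (d : measure_display) (T : measurableType d)
    (R : realType) (P : probability T R) (X : T -> R) (eps : nat -> T -> R) :
    Prop :=
  forall (B : set R) (A : set T), measurable B ->
    noise_sigma_algebra eps setT A ->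
    (P (X @^-1` B `&` A) = P (X @^-1` B) * P A)%E.

(* E[eps_{k+1} | eps_0, ..., eps_k] = 0.  Centred and mutually independent
   eps_k satisfy this.  Means alone do not suffice: for N = 2, eps_2 = eps_1
   the state x_1 predicts eps_2, and the optimal feedback exploits this. *)
Definition centered_given_past (d : measure_display) (T : measurableType d)
    (R : realType) (P : probability T R) (eps : nat -> T -> R) : Prop :=
  forall (k : nat) (A : set T), noise_sigma_algebra eps `I_k.+1 A ->
    (\int[P]_(w in A) (eps k.+1 w)%:E = 0)%E.

(* Main.v *)
Require Import Defs.
From HB Require Import structures.
From mathcomp Require Import all_boot all_order all_algebra.
From mathcomp Require Import all_classical all_reals all_analysis.
From mathcomp Require Import measurable_realfun.
From mathcomp Require Import ring lra.

Set Implicit Arguments.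
Unset Strict Implicit.
Unset Printing Implicit Defensive.

Import Order.TTheory GRing.Theory Num.Theory.
Import numFieldNormedType.Exports.

Local Open Scope classical_set_scope.
Local Open Scope ring_scope.

(** When agent [i] alone deviates from an affine profile, its control problem
    splits into two parts which do not interact: the centred state, with a
    quadratic cost, and the mean of the state, with a quartic cost.  In both
    parts the cost is a constant plus nonnegative terms.

    Take a deviating strategy of finite cost.  Up to the horizon, all states,
    all controls of agent [i] and hence all noises are square integrable.
    With [x'] the next state, [v] the control of agent [i] and [K] its gain,
      r V(v) + alpha_{k+1} V(x')
        = (alpha_k - q) V(x) + alpha_{k+1} V(eps_{k+1})
          + (r + alpha_{k+1} b^2) V(v + K a x)
    ([deviate_state_variance]): the gain equation [E g = c] says precisely that
    [K] is the best response to the gains of the other agents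
    ([gain_best_response]).  For the means, convexity of the fourth power and
    the first-order condition, which the cube root in [cbar] solves, give
      (alphabar_k - qbar) m^4 <= rbar z^4 + alphabar_{k+1} (A m + b z)^4
    with equality at the prescribed control ([quartic_best_response]).  Summing
    over [k] telescopes: the cost is a quantity that depends only on the initial
    state and on the noise, plus one nonnegative term [regret k] per step, which
    vanishes when agent [i] does not deviate ([cost_regret]).

    The variance identity needs [eps k.+1] to be uncorrelated with the state and
    the control at step [k].  Up to null sets these are functions of [x0, eps_0,
    ..., eps_k] ([state_adapted], [control_adapted]).  By independence of [x0]
    and the centring assumption, the noise integrates to zero on the
    intersection of an event [x0 \in B] with a past noise event; hence on every
    event of the sigma-algebra generated by these intersections; hence against
    every function measurable for it ([adapted_covariance_eps]).

    The matrices [E] and [Ebar] are invertible because [0 <= c_i b_i < 1]: they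
    have the form [D + c b^T] with [D] a positive diagonal matrix and
    [b^T D^-1 c >= 0] ([Emx_unitmx]). *)

(** * Gains and one-step best responses *)

(** [Emx c b] is [diag (1 - c_i b_i)] plus the rank-one matrix [c b^T].  A row
    [v] of its left kernel is determined by the scalar [s = v c], and the product
    with [c] gives [s (1 + \sum_i c_i b_i / (1 - c_i b_i)) = 0], whose second
    factor is positive. *)
Lemma Emx_unitmx (R : realType) (n : nat) (c : 'cV[R]_n) (b : 'I_n -> R) :
  (forall i, 0 <= c i 0 * b i < 1) -> Emx c b \in unitmx.
Proof.
move=> cb; rewrite -row_free_unit; apply: inj_row_free => v /rowP vE.
have cbN i : 1 - c i 0 * b i != 0.
  by have /andP[_ lt1] := cb i; rewrite gt_eqF// subr_gt0.
set s := \sum_i v 0 i * c i 0.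
have vj j : v 0 j = - (s * b j) / (1 - c j 0 * b j).
  apply: (mulIf (cbN j)); rewrite divfK//; apply/eqP; rewrite -addr_eq0.
  have := vE j; rewrite !mxE (bigD1 j)//= mxE eqxx.
  under eq_bigr => i /negPf ij do rewrite mxE ij mulrA.
  have -> : s = v 0 j * c j 0 + \sum_(i | i != j) v 0 i * c i 0.
    by rewrite /s (bigD1 j).
  by rewrite -mulr_suml => vE0; apply/eqP; rewrite -[RHS]vE0; ring.
have s0 : s = 0.
  have sE : s * (1 + \sum_i c i 0 * b i / (1 - c i 0 * b i)) = 0.
    rewrite mulrDr mulr1 mulr_sumr {1}/s -big_split/=.
    by apply: big1 => i _; rewrite vj; field.
  move/eqP: sE; rewrite mulf_eq0 => /orP[/eqP//|].
  rewrite gt_eqF// ltr_wpDr//; apply: sumr_ge0 => i _.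
  by have /andP[ge0 lt1] := cb i; rewrite divr_ge0// subr_ge0 ltW.
by apply/rowP => j; rewrite vj s0 mxE mul0r oppr0 mul0r.
Qed.

(** Row [i] of [E g = c]: the gains of the other agents multiply the drift
    seen by agent [i] by [1 - \sum_(j != i) g_j b_j], and [c_i] is the gain that
    is optimal for agent [i] alone. *)
Lemma gain_best_response (R : realType) (n : nat) (c : 'cV[R]_n)
    (b : 'I_n -> R) (i : 'I_n) : Emx c b \in unitmx ->
  gain c b i = c i 0 * (1 - \sum_(j | j != i) gain c b j * b j).
Proof.
move=> uE; have /colP/(_ i) : Emx c b *m (invmx (Emx c b) *m c) = c.
  by rewrite mulmxA mulmxV// mul1mx.
rewrite mxE (bigD1 i)//= mxE eqxx mul1r -/(gain c b i) => cE.
rewrite mulrBr mulr1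
  -[LHS](addrK (\sum_(j | j != i) c i 0 * b j * gain c b j)).
congr (_ - _); last first.
  by rewrite mulr_sumr; apply: eq_bigr => j _; rewrite -mulrA (mulrC (b j)).
rewrite -[RHS]cE; congr (_ + _); apply: eq_bigr => j ji.
by rewrite mxE eq_sym (negPf ji).
Qed.

Lemma cvec_mul_bounds (R : realType) (n : nat) (r alpha b : 'I_n -> R)
    (i : 'I_n) : 0 < r i -> 0 < alpha i -> 0 <= cvec r alpha b i 0 * b i < 1.
Proof.
move=> r0 a0; rewrite mxE.
have ab0 : 0 <= alpha i * b i ^+ 2 by rewrite mulr_ge0 ?sqr_ge0// ltW.
have d0 : 0 < r i + alpha i * b i ^+ 2 by rewrite ltr_wpDr.
rewrite mulrAC -[_ * b i * b i]mulrA -expr2 divr_ge0 ?(ltW d0)//=.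
by rewrite ltr_pdivrMr// mul1r ltrDr.
Qed.

Lemma cbrtK (R : realType) (x : R) : cbrt x ^+ 3 = x.
Proof.
have -> : cbrt x ^+ 3 = Num.sg x * Num.sg x ^+ 2 * `|x|.
  rewrite /cbrt exprMn exprS; congr (_ * _).
  by rewrite -powR_mulrn ?powR_ge0// -powRrM mulVf// powRr1.
rewrite sqr_sg; have [->|_] := eqVneq x 0; first by rewrite normr0 mulr0.
by rewrite mulr1 -numEsg.
Qed.

Lemma cbrt_mul_ge0 (R : realType) (x y : R) : 0 <= x * y -> 0 <= cbrt x * y.
Proof.
rewrite /cbrt mulrAC => xy0; apply: mulr_ge0; last exact: powR_ge0.
case: (sgrP x) xy0 => [|x0|x0]; rewrite ?mul0r ?mul1r ?mulN1r//.
  by rewrite pmulr_rge0.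
by rewrite nmulr_rge0// oppr_ge0.
Qed.

Lemma cbarvec_mul_bounds (R : realType) (n : nat) (r alpha b : 'I_n -> R)
    (i : 'I_n) : 0 < r i -> 0 < alpha i ->
  0 <= cbarvec r alpha b i 0 * b i < 1.
Proof.
move=> r0 a0; rewrite mxE.
set t := cbrt _; have tb0 : 0 <= t * b i.
  apply: cbrt_mul_ge0; rewrite mulrAC -[_ * b i * b i]mulrA -expr2.
  by rewrite divr_ge0 ?(ltW r0)// mulr_ge0 ?sqr_ge0// ltW.
have d0 : 0 < 1 + t * b i by rewrite ltr_wpDr.
rewrite mulrAC divr_ge0 ?(ltW d0)//=.
by rewrite ltr_pdivrMr// mul1r ltrDr.
Qed.

Lemma quartic_tangent (R : realFieldType) (x y : R) :
  y ^+ 4 + 4 * y ^+ 3 * (x - y) <= x ^+ 4.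
Proof.
rewrite -subr_ge0.
have -> : x ^+ 4 - (y ^+ 4 + 4 * y ^+ 3 * (x - y)) =
    (x - y) ^+ 2 * ((x + y) ^+ 2 + 2 * y ^+ 2) by ring.
apply: mulr_ge0; first exact: sqr_ge0.
by apply: addr_ge0; [exact: sqr_ge0 | apply: mulr_ge0 => //; exact: sqr_ge0].
Qed.

(** The control [w] solves [w = - t (y + b w)]; since [r t^3 = alpha b], it is a
    critical point of the right-hand side, which lies above its tangents by
    convexity. *)
Lemma quartic_best_response (R : realType) (r alpha b y v w t : R) :
  0 < r -> 0 < alpha -> t = cbrt (alpha * b / r) -> 0 <= t * b ->
  w = - (t / (1 + t * b)) * y ->
  r * w ^+ 4 + alpha * (y + b * w) ^+ 4 <=
  r * v ^+ 4 + alpha * (y + b * v) ^+ 4.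
Proof.
move=> r0 a0 tE tb0 wE.
have d0 : 1 + t * b != 0 by rewrite gt_eqF// ltr_wpDr.
have stat : r * w ^+ 3 + alpha * b * (y + b * w) ^+ 3 = 0.
  have rt3 : r * t ^+ 3 = alpha * b by rewrite tE cbrtK mulrC divfK// gt_eqF.
  have wz : w = - t * (y + b * w) by rewrite wE; field.
  by rewrite -rt3 {1}wz; ring.
have := lerD (ler_wpM2l (ltW r0) (quartic_tangent v w))
  (ler_wpM2l (ltW a0) (quartic_tangent (y + b * v) (y + b * w))).
apply: le_trans; rewrite -subr_ge0 le_eqVlt; apply/orP; left; rewrite eq_sym.
apply/eqP; transitivity
  (4 * (v - w) * (r * w ^+ 3 + alpha * b * (y + b * w) ^+ 3)).
  by ring.
by rewrite stat mulr0.
Qed.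

(** * Functions orthogonal to a sigma-algebra *)

Lemma sub_sigma_measurable d (T : measurableType d) (G : set (set T)) :
  G `<=` measurable -> <<s G >> `<=` (measurable : set (set T)).
Proof.
by move=> Gm; apply: smallest_sub => //; exact: sigma_algebra_measurable.
Qed.

Lemma sub_sigma_measurable_fun d (T : measurableType d) d'
    (T' : measurableType d') (G : set (set T)) (h : T -> T') :
  G `<=` measurable ->
  measurable_fun setT (h : g_sigma_algebraType G -> T') ->
  measurable_fun setT h.
Proof.
move=> Gm mh _ B mB; apply: (sub_sigma_measurable Gm).
exact: (mh measurableT B mB).
Qed.

Section orthogonality.
Context d (T : measurableType d) (R : realType).
Variable P : probability T R.
Variables (G : set (set T)) (e : T -> R).
Hypothesis Gm : G `<=` measurable.
Hypothesis ie : P.-integrable setT (EFin \o e).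
Hypothesis e0 : forall A, <<s G >> A -> (\int[P]_(w in A) (e w)%:E = 0)%E.

Import HBNNSimple.

Lemma nnsfun_integral_mul_eq0 (h : {nnsfun (g_sigma_algebraType G) >-> R}) :
  (\int[P]_w (h w * e w)%:E = 0)%E.
Proof.
have mh y : <<s G >> (h @^-1` [set y]) by exact: (measurable_sfunP h).
have mTh y : measurable (h @^-1` [set y] : set T).
  exact: (sub_sigma_measurable Gm).
pose r := finmap.enum_fset (fset_set (range h)).
transitivity (\int[P]_w \sum_(y <- r)
    (y%:E * ((EFin \o e) \_ (h @^-1` [set y])) w))%E.
  apply: eq_integral => w _; rewrite fimfunE fsbig_finite//= mulr_suml -sumEFin.
  apply: eq_bigr => y _; rewrite indicE patchE.
  by case: (w \in _); rewrite ?mulr1 ?mulr0 ?mul0r ?mule0.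
rewrite integral_sum//; last first.
  move=> y; apply: integrableZl => //.
  by apply/integrable_restrict => //; rewrite setTI; exact: integrableS ie.
apply: big1 => y _; rewrite integralZl//; last first.
  by apply/integrable_restrict => //; rewrite setTI; exact: integrableS ie.
by rewrite -integral_mkcond e0// mule0.
Qed.

Lemma ge0_integral_mul_eq0 (h : T -> R) : (forall w, 0 <= h w) ->
  measurable_fun setT (h : g_sigma_algebraType G -> R) ->
  P.-integrable setT (fun w => (h w * e w)%:E) ->
  (\int[P]_w (h w * e w)%:E = 0)%E.
Proof.
move=> h0 mh ihe.
have mEh : measurable_fun setT (EFin \o h : g_sigma_algebraType G -> \bar R).
  exact/measurable_EFinP.
have hE0 w : (setT : set (g_sigma_algebraType G)) w -> (0 <= (EFin \o h) w)%E.
  by move=> _; rewrite lee_fin.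
pose g_ n := nnsfun_approx measurableT mEh n.
have me : measurable_fun setT e by exact/measurable_EFinP/(measurable_int P).
have mg n : measurable_fun setT (g_ n : T -> R).
  by apply: (sub_sigma_measurable_fun Gm).
have [|||||_ _] := @dominated_convergence _ T R P setT measurableT
    (fun n w => (g_ n w * e w)%:E) (fun w => (h w * e w)%:E)
    (abse \o (fun w => (h w * e w)%:E)).
- by move=> n; apply/measurable_EFinP; exact: measurable_funM.
- exact: measurable_int ihe.
- apply: aeW => w _; under eq_fun do rewrite EFinM.
  rewrite EFinM; apply: cvgeZr => //.
  exact: (cvg_nnsfun_approx measurableT mEh hE0 (x := w)).
- exact: integrable_abse.
- apply: aeW => w n _; rewrite /= lee_fin !normrM ler_wpM2r//.
  rewrite ger0_norm// ger0_norm//.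
  by rewrite /g_ nnsfun_approxE -lee_fin; exact: (le_approx (f := EFin \o h)).
under eq_fun do rewrite nnsfun_integral_mul_eq0.
by move=> /cvg_lim <- //; rewrite lim_cst.
Qed.

(** Approximation of [h] by [<<s G>>]-simple functions, which are orthogonal to
    [e] by hypothesis; the integrability of [h * e] provides the domination. *)
Lemma integral_mul_eq0 (h : T -> R) :
  measurable_fun setT (h : g_sigma_algebraType G -> R) ->
  P.-integrable setT (fun w => (h w * e w)%:E) ->
  (\int[P]_w (h w * e w)%:E = 0)%E.
Proof.
move=> mh ihe.
have me : measurable_fun setT e by exact/measurable_EFinP/(measurable_int P).
have part (p : T -> R) : (forall w, 0 <= p w) -> (forall w, p w <= `|h w|) ->
    measurable_fun setT (p : g_sigma_algebraType G -> R) ->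
    P.-integrable setT (fun w => (p w * e w)%:E) /\
    (\int[P]_w (p w * e w)%:E = 0)%E.
  move=> p0 ph mp.
  have ip : P.-integrable setT (fun w => (p w * e w)%:E).
    apply: (le_integrable measurableT _ _ ihe) => [|w _].
      apply/measurable_EFinP/measurable_funM => //.
      exact: (sub_sigma_measurable_fun Gm).
    by rewrite /= lee_fin !normrM ler_wpM2r// ger0_norm.
  by split => //; exact: ge0_integral_mul_eq0.
have [|||ip Ip] := part h^\+.
- exact: funrpos_ge0.
- by move=> w; rewrite /funrpos ge_max normr_ge0 ler_norm.
- exact: measurable_funrpos.
have [|||iN IN] := part h^\-.
- exact: funrneg_ge0.
- by move=> w; rewrite /funrneg ge_max normr_ge0 -normrN ler_norm.
- exact: measurable_funrneg.
transitivity (\int[P]_w ((h^\+ w * e w)%:E - (h^\- w * e w)%:E))%E.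
  apply: eq_integral => w _; rewrite -EFinB -mulrBl.
  by congr (_ * _)%:E; rewrite -[in LHS](funrposBneg h).
by rewrite integralB// Ip IN sube0.
Qed.

End orthogonality.

(** * The information carried by the initial state and the past noise *)

(** A pi-system rather than the sigma-algebra of [x0, eps_0, ..., eps_k] that it
    generates: independence of [x0] computes integrals over its members, and
    Dynkin's theorem extends the result to [<<s history x0 eps k>>]. *)
Definition history (T : Type) (R : realType) (x0 : T -> R)
    (eps : nat -> T -> R) (k : nat) : set (set T) :=
  [set x0 @^-1` B `&` A | B in (measurable : set (set R))
                        & A in noise_sigma_algebra eps `I_k.+1].

Section history.
Context d (T : measurableType d) (R : realType).
Variable P : probability T R.
Variables (x0 : {RV P >-> R}) (eps : nat -> {RV P >-> R}).

Local Notation H := (history x0 eps).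

Let noise_gen (J : set nat) :=
  [set (eps k : T -> R) @^-1` B | k in J & B in (measurable : set (set R))].

Lemma noise_sub (J : set nat) : noise_gen J `<=` (measurable : set (set T)).
Proof. by move=> _ [k _ [B mB <-]]; exact: measurable_funPTI. Qed.

Lemma noise_mono (J K : set nat) : J `<=` K ->
  noise_sigma_algebra eps J `<=` noise_sigma_algebra eps K.
Proof.
move=> JK; apply: sub_sigma_algebra2.
by move=> _ [k Jk [B mB <-]]; exists k; [exact: JK | exists B].
Qed.

Lemma noise_measurable (J : set nat) :
  noise_sigma_algebra eps J `<=` (measurable : set (set T)).
Proof. exact: (sub_sigma_measurable (@noise_sub J)). Qed.

Lemma history_sub k : H k `<=` (measurable : set (set T)).
Proof.
move=> _ [B mB [A nA <-]]; apply: measurableI; first exact: measurable_funPTI.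
exact: noise_measurable nA.
Qed.

Lemma noiseI (J : set nat) A B : noise_sigma_algebra eps J A ->
  noise_sigma_algebra eps J B -> noise_sigma_algebra eps J (A `&` B).
Proof. exact: (@measurableI _ (g_sigma_algebraType (noise_gen J))). Qed.

Lemma history_setI_closed k : setI_closed (H k).
Proof.
move=> _ _ [B mB [A nA <-]] [B' mB' [A' nA' <-]].
exists (B `&` B'); first exact: measurableI.
exists (A `&` A'); first exact: noiseI.
by rewrite preimage_setI setIACA.
Qed.

Lemma history_mono k : H k `<=` H k.+1.
Proof.
move=> _ [B mB [A nA <-]]; exists B => //; exists A => //.
by apply: noise_mono nA => i /= /ltnW; rewrite ltnS.
Qed.

Lemma history_funS k (f : T -> R) :
  measurable_fun setT (f : g_sigma_algebraType (H k) -> R) ->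
  measurable_fun setT (f : g_sigma_algebraType (H k.+1) -> R).
Proof.
move=> mf _ B mB; have := mf measurableT B mB.
by apply: sub_sigma_algebra2; exact: history_mono.
Qed.

Lemma history_x0 k :
  measurable_fun setT (x0 : g_sigma_algebraType (H k) -> R).
Proof.
move=> _ B mB; rewrite setTI; apply: sub_sigma_algebra; exists B => //.
exists setT; last by rewrite setIT.
exact: (@measurableT _ (g_sigma_algebraType (noise_gen `I_k.+1))).
Qed.

Lemma history_eps k :
  measurable_fun setT (eps k : g_sigma_algebraType (H k) -> R).
Proof.
move=> _ B mB; rewrite setTI; apply: sub_sigma_algebra.
exists setT => //; exists (eps k @^-1` B); last by rewrite preimage_setT setTI.
by apply: sub_sigma_algebra; exists k => /=; [exact: ltnSn | exists B].
Qed.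

Hypothesis epsmean : forall k, ('E_P[eps k] = 0)%E.
Hypothesis epspast : centered_given_past P eps.
Hypothesis x0_indep : independent_of_noise P x0 eps.

(** As [+oo - +oo] is [-oo], an integral is finite only if the positive and
    negative parts have finite integrals. *)
Lemma eps_integrable k : P.-integrable setT (EFin \o eps k).
Proof.
apply/integrableP; split; first exact/measurable_EFinP.
apply/abse_integralP => //; first exact/measurable_EFinP.
by have := epsmean k; rewrite unlock /= => ->; rewrite abse0 ltry.
Qed.

(** By independence, [\1_(x0 \in B) - P (x0 \in B)] integrates to zero over
    every noise event, so it is orthogonal to the noise variable [\1_A' * eps k.+1];
    and the latter has zero integral since [A'] is a past noise event. *)
Lemma history_gen_integral_eps k A : H k A ->
  (\int[P]_(w in A) (eps k.+1 w)%:E = 0)%E.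
Proof.
move=> [B mB [A' nA' <-]].
have mA' := noise_measurable nA'.
have mX : measurable (x0 @^-1` B) by exact: measurable_funPTI.
pose p := fine (P (x0 @^-1` B)).
have pE : P (x0 @^-1` B) = p%:E by rewrite fineK// fin_num_measure.
pose phi w : R := \1_(x0 @^-1` B) w - p.
pose h w : R := \1_A' w * eps k.+1 w.
have iphi : P.-integrable setT (EFin \o phi).
  have := integrableB measurableT (integrable_indic P mX)
    (finite_measure_integrable_cst P p measurableT).
  by apply: eq_integrable.
have ih : P.-integrable setT (EFin \o h).
  have /integrable_mkcond : P.-integrable A' (EFin \o eps k.+1).
    by apply: integrableS (eps_integrable _).
  move=> /(_ mA'); apply: eq_integrable => // w _.
  by rewrite /h /= patchE indicE; case: (w \in _); rewrite ?mul1r ?mul0r.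
have Ih : (\int[P]_w (h w)%:E = 0)%E.
  rewrite -[RHS](epspast nA').
  rewrite [RHS]integral_mkcond; apply: eq_integral => w _.
  by rewrite /h /= patchE indicE; case: (w \in _); rewrite ?mul1r ?mul0r.
have phi0 C : noise_sigma_algebra eps setT C ->
    (\int[P]_(w in C) (phi w)%:E = 0)%E.
  move=> nC; have mC := noise_measurable nC.
  rewrite /phi; under eq_integral do rewrite EFinB.
  rewrite integralB//; last 2 first.
  - apply: (integrableS measurableT mC (subsetT _)).
    exact: integrable_indic.
  - exact: finite_measure_integrable_cst.
  rewrite integral_indic// (integral_cst P mC p%:E).
  rewrite [X in (X - _)%E](_ : _ = (p%:E * P C)%E); last first.
    by rewrite -pE; exact: x0_indep.
  by rewrite subee// fin_numM// fin_num_measure.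
have ihphi : P.-integrable setT (fun w => (h w * phi w)%:E).
  apply: (le_integrable measurableT _ _ ih).
    apply/measurable_EFinP/measurable_funM; apply/measurable_EFinP.
      exact: measurable_int ih.
    exact: measurable_int iphi.
  move=> w _ /=; rewrite lee_fin normrM ler_piMr//.
  have p0 : 0 <= p by rewrite fine_ge0.
  have p1 : p <= 1 by rewrite -lee_fin -pE; exact: probability_le1.
  by rewrite /phi indicE ler_norml; case: (_ \in _) => /=; lra.
have hphi0 : (\int[P]_w (h w * phi w)%:E = 0)%E.
  apply: (@integral_mul_eq0 _ _ _ P (noise_gen setT)) => //.
  - exact: noise_sub.
  - apply: measurable_funM.
    + apply: measurable_indic; apply: noise_mono nA' => //.
    + move=> _ C mC; rewrite setTI; apply: sub_sigma_algebra.
      by exists k.+1 => //; exists C.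
transitivity (\int[P]_w ((h w * phi w)%:E + p%:E * (h w)%:E))%E.
  rewrite integral_mkcond; apply: eq_integral => w _.
  rewrite patchE /h /phi indicE in_setI -EFinM -EFinD indicE.
  by case: (w \in _); case: (w \in _) => /=; congr _%:E; ring.
rewrite integralD//; last exact: integrableZl.
by rewrite hphi0 integralZl// Ih mule0 add0e.
Qed.

Lemma history_integral_eps k A : <<s H k >> A ->
  (\int[P]_(w in A) (eps k.+1 w)%:E = 0)%E.
Proof.
have ie := eps_integrable k.+1.
have I0 : (\int[P]_w (eps k.+1 w)%:E = 0)%E.
  by have := epsmean k.+1; rewrite unlock.
rewrite -(setI_closed_g_dynkin_g_sigma_algebra (@history_setI_closed k)).
pose D := [set A : set T | measurable A /\
  (\int[P]_(w in A) (eps k.+1 w)%:E = 0)%E].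
suff : <<d H k >> `<=` D by move=> HD /HD[].
apply: smallest_sub; last first.
  move=> B HB; split; first exact: history_sub HB.
  exact: history_gen_integral_eps.
split => [|B [mB IB]|F tF FD].
- by split.
- split; first exact: measurableC.
  have : (\int[P]_(w in B `|` ~` B) (eps k.+1 w)%:E = 0)%E by rewrite setUv.
  rewrite integral_setU ?IB ?add0e//.
  + exact: measurableC.
  + by rewrite setUv; exact: measurable_int ie.
  + by apply/disj_setPS; rewrite setICr.
- have mF n : measurable (F n) by have [] := FD n.
  split; first exact: bigcup_measurable.
  rewrite integral_bigcup//.
    by rewrite eseries0// => n _ _; have [] := FD n.
  apply: integrableS ie => //; exact: bigcup_measurable.
Qed.

End history.

(** * Square-integrable random variables *)

Section square_integrable.
Context d (T : measurableType d) (R : realType).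
Variable P : probability T R.

Local Notation L2 := (Lfun P 2%:E).
Local Notation var X := (fine 'V_P[X]).
Local Notation cov X Y := (fine (covariance P X Y)).

Lemma Lfun2_Lfun1 X : X \in L2 -> X \in Lfun P 1.
Proof. by apply: Lfun_subset12; exact: fin_num_measure. Qed.

Lemma eq_Lfun2 (X Y : T -> R) : X =1 Y -> Y \in L2 -> X \in L2.
Proof. by move=> /funext ->. Qed.

Lemma Lfun2D (X Y : T -> R) : X \in L2 -> Y \in L2 -> X \+ Y \in L2.
Proof. by move=> X2 Y2; rewrite rpredD ?lee1n//= => _. Qed.

Lemma Lfun2_affine (X Y : T -> R) (a b c : R) : X \in L2 -> Y \in L2 ->
  (fun w => a * X w + b * Y w + c) \in L2.
Proof.
move=> X2 Y2.
have -> : (fun w => a * X w + b * Y w + c) = (a \o* X \+ b \o* Y \+ cst c).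
  by apply/funext => w /=; rewrite !(mulrC _ a, mulrC _ b).
by rewrite !Lfun2D ?Lfun_cst ?Lfun_scale ?ler1n.
Qed.

(** The variance is centred at a real number [m] whether or not [X] has a mean,
    so [X - m] is square integrable, and so is [X]. *)
Lemma Lfun2_of_variance (X : T -> R) :
  measurable_fun setT X -> ('V_P[X] < +oo)%E -> X \in L2.
Proof.
move=> mX; rewrite /variance unlock; set m := fine _; rewrite unlock => Voo.
suff X2 : (fun w => X w - m) \in L2.
  have -> : X = (fun w => 1 * (X w - m) + 0 * (X w - m) + m).
    by apply/funext => w; rewrite mul1r mul0r addr0 subrK.
  exact: Lfun2_affine.
have mXm : measurable_fun setT (fun w => X w - m) by exact: measurable_funB.
rewrite inE; apply/andP; split; rewrite inE//=.
rewrite /finite_norm unlock /Lnorm poweR_lty//.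
apply: le_lt_trans Voo; apply: ge0_le_integral => //=.
- apply/measurable_EFinP.
  apply: (measurableT_comp (f := fun x : R => x `^ 2)) => //.
  exact: measurableT_comp.
- by apply/measurable_EFinP; exact: measurable_funM.
- by move=> w _; rewrite lee_fin powR_mulrn// real_normK ?num_real// expr2.
Qed.

Lemma mean_affine (X Y : T -> R) (a b c : R) :
  X \in Lfun P 1 -> Y \in Lfun P 1 ->
  mean P (fun w => a * X w + b * Y w + c) = a * mean P X + b * mean P Y + c.
Proof.
move=> X1 Y1; rewrite /mean.
have -> : (fun w => a * X w + b * Y w + c) = (a \o* X \+ b \o* Y \+ cst c).
  by apply/funext => w /=; rewrite !(mulrC _ a, mulrC _ b).
have aX1 := Lfun_scale a (lexx _) X1; have bY1 := Lfun_scale b (lexx _) Y1.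
rewrite !expectationD ?expectationZl ?expectation_cst ?rpredD ?Lfun_cst//.
by rewrite !fineD ?fineM ?fin_numD ?fin_numM ?expectation_fin_num.
Qed.

Lemma variance_affine (X Y : T -> R) (a b c : R) : X \in L2 -> Y \in L2 ->
  var (fun w => a * X w + b * Y w + c) =
  a ^+ 2 * var X + b ^+ 2 * var Y + 2 * a * b * cov X Y.
Proof.
move=> X2 Y2.
have -> : (fun w => a * X w + b * Y w + c) = (a \o* X \+ b \o* Y \+ cst c).
  by apply/funext => w /=; rewrite !(mulrC _ a, mulrC _ b).
have X1 := Lfun2_Lfun1 X2; have Y1 := Lfun2_Lfun1 Y2.
have XY1 := Lfun2_mul_Lfun1 X2 Y2.
have aX2 : a \o* X \in L2 by rewrite Lfun_scale// ler1n.
have bY2 : b \o* Y \in L2 by rewrite Lfun_scale// ler1n.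
have bY1 := Lfun2_Lfun1 bY2.
rewrite varianceD_cst_r ?Lfun2D// varianceD// !varianceZ//.
have -> : covariance P (a \o* X) (b \o* Y) =
    (a%:E * (b%:E * covariance P X Y))%E.
  by rewrite covarianceZl ?covarianceZr//; exact: Lfun2_mul_Lfun1.
rewrite !fineD ?fineM ?fin_numD ?fin_numM ?variance_fin_num
  ?covariance_fin_num//=.
by ring.
Qed.

End square_integrable.

(** * States and controls are functions of the past *)

Section adapted.
Context d (T : measurableType d) (R : realType).
Variable P : probability T R.
Variables (x0 : {RV P >-> R}) (eps : nat -> {RV P >-> R}).

(** Measurability up to a null set is all that a well-posed closed loop gives,
    because the controls agree only almost surely with Borel functions of the
    state. *)
Definition adapted (k : nat) (z : T -> R) : Prop :=
  exists2 h : T -> R,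
    measurable_fun setT (h : g_sigma_algebraType (history x0 eps k) -> R) &
    {ae P, forall w, z w = h w}.

Lemma adapted_affine k (y z : T -> R) (a b c : R) :
  adapted k y -> adapted k z -> adapted k (fun w => a * y w + b * z w + c).
Proof.
move=> [g mg yg] [h mh zh]; exists (fun w => a * g w + b * h w + c).
  apply: measurable_funD; last exact: measurable_cst.
  by apply: measurable_funD;
    apply: measurable_funM => //; exact: measurable_cst.
by apply: filterS2 yg zh => w -> ->.
Qed.

Hypothesis epsmean : forall k, ('E_P[eps k] = 0)%E.
Hypothesis epspast : centered_given_past P eps.
Hypothesis x0_indep : independent_of_noise P x0 eps.

Lemma adapted_covariance_eps k z : adapted k z -> z \in Lfun P 2%:E ->
  (eps k.+1 : T -> R) \in Lfun P 2%:E -> covariance P z (eps k.+1) = 0%E.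
Proof.
move=> [h mh zh] z2 e2.
have ze1 := Lfun2_mul_Lfun1 z2 e2.
rewrite (covarianceE (Lfun2_Lfun1 z2) (Lfun2_Lfun1 e2) ze1).
rewrite epsmean mule0 sube0 unlock.
have ize : P.-integrable setT (fun w => (z w * eps k.+1 w)%:E).
  by move/Lfun1_integrable : ze1.
have mhe : measurable_fun setT (fun w => (h w * eps k.+1 w)%:E).
  apply/measurable_EFinP/measurable_funM => //.
  exact: (sub_sigma_measurable_fun (@history_sub _ _ _ _ x0 eps k)).
have zehe : ae_eq P setT (fun w => (z w * eps k.+1 w)%:E)
    (fun w => (h w * eps k.+1 w)%:E).
  by apply: filterS zh => w -> _.
rewrite (ae_eq_integral (fun w => (h w * eps k.+1 w)%:E))//; last first.
  exact: measurable_int ize.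
apply: (integral_mul_eq0 (@history_sub _ _ _ _ x0 eps k)) => //.
- exact: eps_integrable.
- by move=> A; exact: history_integral_eps.
- apply/integrableP; split => //.
  have /integrableP[mze] := ize; apply: le_lt_trans.
  apply: ae_ge0_le_integral => //; do ?[exact: measurableT_comp].
  by apply: filterS zehe => w /(_ I) ->.
Qed.

End adapted.

Section closed_loop.
Context d (T : measurableType d) (R : realType).
Variables (P : probability T R) (n N : nat) (a : nat -> R).
Variables (b : 'I_n -> nat -> R).
Variables (x0 : {RV P >-> R}) (eps : nat -> {RV P >-> R}).
Variable u : 'I_n -> feedback R.
Hypothesis wp : well_posed P N a b x0 eps u.

Local Notation x := (state P a b x0 eps u).
Local Notation v := (control P a b x0 eps u).

Lemma state_measurable k : (k <= N)%N -> measurable_fun setT (x k).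
Proof.
elim: k => [|k IH] kN; first by [].
apply: measurable_funD => //; apply: measurable_funD.
  by apply: measurable_funM => //; exact: IH (ltnW kN).
apply: measurable_sum => i; apply: measurable_funM => //.
by have [] := wp i kN.
Qed.

Lemma state_adapted k : (k <= N)%N -> adapted x0 eps k (x k).
Proof.
elim: k => [|k IH] kN.
  by exists x0; [exact: history_x0 | exact: aeW].
have [h mh xh] := IH (ltnW kN).
have /choice[g vg] : forall i, exists g : R -> R, measurable_fun setT g /\
    {ae P, forall w, v i k w = g (x k w)}.
  by move=> i; have [_] := wp i kN.
exists (fun w => a k * h w + \sum_(i < n) b i k * g i (h w) + eps k.+1 w).
  apply: measurable_funD; last exact: history_eps.
  apply: measurable_funD.
    by apply: measurable_funM => //; exact: history_funS.
  apply: measurable_sum => i; apply: measurable_funM => //.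
  apply: measurableT_comp; first by have [] := vg i.
  exact: history_funS.
have : {ae P, forall w, forall i, v i k w = g i (x k w)}.
  by apply: filter_forall => i; have [] := vg i.
apply: filterS2 xh => w /= xw vw; rewrite -xw.
by congr (_ + _ + _); apply: eq_bigr => i _; rewrite -vw.
Qed.

Lemma control_adapted i k : (k < N)%N -> adapted x0 eps k (v i k).
Proof.
move=> kN; have [h mh xh] := state_adapted (ltnW kN).
have [_ [g [mg vg]]] := wp i kN.
exists (g \o h); first exact: measurableT_comp.
by apply: filterS2 xh vg => w /= -> ->.
Qed.

End closed_loop.

(** * The cost of a unilateral deviation *)

(** Completion of the square.  The condition on [gamma] makes [V = - gamma X]
    stationary for the left-hand side, so that the terms in the covariance of
    [X] and [V + gamma X] cancel. *)
Lemma variance_step d (T : measurableType d) (R : realType)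
    (P : probability T R) (X V Z : T -> R) (A b kappa gamma r alpha : R) :
  X \in Lfun P 2%:E -> V \in Lfun P 2%:E -> Z \in Lfun P 2%:E ->
  covariance P (fun w => A * X w + b * V w + kappa) Z = 0%E ->
  (r + alpha * b ^+ 2) * gamma = alpha * b * A ->
  r * fine 'V_P[V] +
    alpha * fine 'V_P[fun w => A * X w + b * V w + kappa + Z w] =
  (r * gamma ^+ 2 + alpha * (A - b * gamma) ^+ 2) * fine 'V_P[X] +
    alpha * fine 'V_P[Z] +
    (r + alpha * b ^+ 2) * fine 'V_P[fun w => 1 * V w + gamma * X w + 0].
Proof.
move=> X2 V2 Z2 XZ0 gammaE.
set Y := fun w => A * X w + b * V w + kappa.
have Y2 : Y \in Lfun P 2%:E by exact: Lfun2_affine.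
have -> : (fun w => A * X w + b * V w + kappa + Z w) =
    (fun w => 1 * Y w + 1 * Z w + 0).
  by apply/funext => w; rewrite !mul1r addr0.
rewrite variance_affine// XZ0 /Y !variance_affine//= (covarianceC P V X).
set vX := fine 'V_P[X]; set cXV := fine (covariance P X V).
apply: subr0_eq.
transitivity ((alpha * b * A - (r + alpha * b ^+ 2) * gamma) *
  (2 * gamma * vX + 2 * cXV)); first by ring.
by rewrite gammaE subrr mul0r.
Qed.

Section deviation.
Context d (T : measurableType d) (R : realType).
Variables (P : probability T R) (n N : nat) (a : nat -> R).
Variables (b q qbar r rbar : 'I_n -> nat -> R).
Variables (x0 : {RV P >-> R}) (eps : nat -> {RV P >-> R}).
Variables (K Kbar : nat -> 'I_n -> R).

Definition affine_feedback (j : 'I_n) (k : nat) (z : R * R) : R :=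
  - Kbar k j * (a k * z.2) - K k j * a k * (z.1 - z.2).

(** The factor by which agent [i] sees its state multiplied in one step when the
    other agents apply the gains [F]. *)
Definition others_drift (F : nat -> 'I_n -> R) (i : 'I_n) (k : nat) : R :=
  a k * (1 - \sum_(j | j != i) F k j * b j k).

Variables (i : 'I_n) (v : feedback R).
Local Notation u := (deviate affine_feedback i v).
Local Notation x := (state P a b x0 eps u).
Local Notation ctl := (control P a b x0 eps u i).

Lemma deviate_stateS k w :
  x k.+1 w = others_drift K i k * x k w + b i k * ctl k w +
    (others_drift Kbar i k - others_drift K i k) * mean P (x k) + eps k.+1 w.
Proof.
have ui : u i = v by rewrite /deviate eqxx.
have uj j : j != i -> u j = affine_feedback j.
  by move=> /negPf; rewrite /deviate => ->.
transitivity (a k * x k w + \sum_(j < n) b j k * u j k (x k w, mean P (x k)) +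
  eps k.+1 w); first by [].
rewrite /control ui (bigD1 i)//= ui; congr (_ + _).
set m := mean P (x k); set y := x k w; set c := b i k * _.
under eq_bigr => j ji.
  rewrite (uj _ ji) /affine_feedback/=.
  rewrite (_ : b j k * _ = - (a k * (y - m)) * (K k j * b j k)
                       - a k * m * (Kbar k j * b j k)); last by ring.
  over.
by rewrite big_split/= sumrN -!mulr_sumr /others_drift; ring.
Qed.

Variables (alpha alphabar : nat -> R).
Hypothesis epsmean : forall k, ('E_P[eps k] = 0)%E.
Hypothesis epspast : centered_given_past P eps.
Hypothesis x0_indep : independent_of_noise P x0 eps.
Hypothesis wp : well_posed P N a b x0 eps u.
Hypothesis x2 : forall k, (k <= N)%N -> x k \in Lfun P 2%:E.
Hypothesis ctl2 : forall k, (k < N)%N -> ctl k \in Lfun P 2%:E.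
Hypothesis eps2 : forall k, (k < N)%N -> (eps k.+1 : T -> R) \in Lfun P 2%:E.
Hypothesis alphaN : alpha N = q i N.
Hypothesis alphabarN : alphabar N = qbar i N.
Hypothesis K_stationary : forall k, (k < N)%N ->
  (r i k + alpha k.+1 * b i k ^+ 2) * (K k i * a k) =
  alpha k.+1 * b i k * others_drift K i k.
Hypothesis alphaE : forall k, (k < N)%N ->
  alpha k = q i k + (r i k * (K k i * a k) ^+ 2 +
    alpha k.+1 * (others_drift K i k - b i k * (K k i * a k)) ^+ 2).

Lemma deviate_state_mean k : (k < N)%N ->
  mean P (x k.+1) =
  others_drift Kbar i k * mean P (x k) + b i k * mean P (ctl k).
Proof.
move=> kN; have xk := x2 (ltnW kN); have vk := ctl2 kN; have ek := eps2 kN.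
set m := mean P (x k).
pose Y w := others_drift K i k * x k w + b i k * ctl k w +
  (others_drift Kbar i k - others_drift K i k) * m.
have Y2 : Y \in Lfun P 2%:E by exact: Lfun2_affine.
have -> : x k.+1 = (fun w => 1 * Y w + 1 * eps k.+1 w + 0).
  by apply/funext => w; rewrite deviate_stateS !mul1r addr0.
have mY : mean P Y = others_drift K i k * m + b i k * mean P (ctl k) +
    (others_drift Kbar i k - others_drift K i k) * m.
  by rewrite mean_affine ?Lfun2_Lfun1.
have me : mean P (eps k.+1) = 0 by rewrite /mean epsmean.
by rewrite mean_affine ?Lfun2_Lfun1// mY me; ring.
Qed.

Lemma deviate_state_variance k : (k < N)%N ->
  r i k * fine 'V_P[ctl k] + alpha k.+1 * fine 'V_P[x k.+1] =
  (alpha k - q i k) * fine 'V_P[x k] + alpha k.+1 * fine 'V_P[eps k.+1] +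
  (r i k + alpha k.+1 * b i k ^+ 2) *
    fine 'V_P[fun w => 1 * ctl k w + K k i * a k * x k w + 0].
Proof.
move=> kN; have xk := x2 (ltnW kN); have vk := ctl2 kN; have ek := eps2 kN.
have -> : x k.+1 = (fun w => others_drift K i k * x k w + b i k * ctl k w +
    (others_drift Kbar i k - others_drift K i k) * mean P (x k) + eps k.+1 w).
  by apply/funext => w; rewrite deviate_stateS.
rewrite (variance_step xk vk ek _ (K_stationary kN)).
  by rewrite [in RHS]alphaE// [q i k + _]addrC addrK.
apply: (adapted_covariance_eps epsmean epspast x0_indep) => //.
- apply: adapted_affine; first exact: (state_adapted wp (ltnW kN)).
  exact: (control_adapted wp i kN).
- exact: Lfun2_affine.
Qed.

(** The excess, at step [k], of the running cost plus the next value
    [alpha V(x) + alphabar m^4] over the current value and the cost of the noise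
    at that step. *)
Definition regret (k : nat) : R :=
  (r i k + alpha k.+1 * b i k ^+ 2) *
    fine 'V_P[fun w => 1 * ctl k w + K k i * a k * x k w + 0] +
  (rbar i k * mean P (ctl k) ^+ 4 +
   alphabar k.+1 * (others_drift Kbar i k * mean P (x k) +
                    b i k * mean P (ctl k)) ^+ 4 -
   (alphabar k - qbar i k) * mean P (x k) ^+ 4).

(** Telescoping sum of the one-step identities. *)
Lemma cost_regret :
  cost P N a b q qbar r rbar x0 eps u i =
  (alpha 0%N * fine 'V_P[x0] + alphabar 0%N * mean P x0 ^+ 4 +
   \sum_(k < N) (alpha k.+1 * fine 'V_P[eps k.+1] + regret k))%:E.
Proof.
pose l k := q i k * fine 'V_P[x k] + qbar i k * mean P (x k) ^+ 4 +
  r i k * fine 'V_P[ctl k] + rbar i k * mean P (ctl k) ^+ 4.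
pose W k := alpha k * fine 'V_P[x k] + alphabar k * mean P (x k) ^+ 4.
have WE M : (M <= N)%N -> W M + \sum_(k < M) l k =
    W 0%N + \sum_(k < M) (alpha k.+1 * fine 'V_P[eps k.+1] + regret k).
  elim: M => [|M IH] MN; first by rewrite !big_ord0.
  rewrite !big_ord_recr/= !addrA -IH ?(ltnW MN)// /W /l /regret.
  rewrite -deviate_state_mean//; have := deviate_state_variance MN.
  by lra.
have VE X : X \in Lfun P 2%:E -> 'V_P[X] = (fine 'V_P[X])%:E.
  by move=> X2; rewrite fineK// variance_fin_num.
transitivity (W N + \sum_(k < N) l k)%:E; last by rewrite WE.
rewrite /cost /W alphaN alphabarN VE ?x2// EFinD; congr (_ + _)%E.
rewrite -sumEFin; apply: eq_bigr => k _.
by rewrite (VE _ (x2 (ltnW (ltn_ord k)))) (VE _ (ctl2 (ltn_ord k))).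
Qed.

End deviation.

Section finite_cost.
Context d (T : measurableType d) (R : realType).
Variables (P : probability T R) (n N : nat) (a : nat -> R).
Variables (b q qbar r rbar : 'I_n -> nat -> R).
Variables (x0 : {RV P >-> R}) (eps : nat -> {RV P >-> R}).
Variables (u : 'I_n -> feedback R) (i : 'I_n).
Hypothesis q0 : forall k, (k <= N)%N -> 0 < q i k.
Hypothesis qbar0 : forall k, (k <= N)%N -> 0 < qbar i k.
Hypothesis r0 : forall k, (k < N)%N -> 0 < r i k.
Hypothesis rbar0 : forall k, (k < N)%N -> 0 < rbar i k.
Hypothesis wp : well_posed P N a b x0 eps u.

Local Notation x := (state P a b x0 eps u).
Local Notation ctl := (control P a b x0 eps u i).

(** Every term of the cost is nonnegative and the weights of the variances are
    positive. *)
Lemma finite_cost_Lfun2 :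
  (cost P N a b q qbar r rbar x0 eps u i < +oo)%E ->
  (forall k, (k <= N)%N -> x k \in Lfun P 2%:E) /\
  (forall k, (k < N)%N -> ctl k \in Lfun P 2%:E).
Proof.
have V0 c X : 0 < c -> (0 <= c%:E * 'V_P[X])%E.
  by move=> c0; rewrite mule_ge0 ?variance_ge0// lee_fin ltW.
have m0 c X : 0 < c -> (0 <= (c * mean P X ^+ 4)%:E)%E.
  by move=> c0; rewrite lee_fin mulr_ge0 ?(ltW c0)// exprn_even_ge0.
have L2 c X : 0 < c -> measurable_fun setT X -> (c%:E * 'V_P[X] < +oo)%E ->
    X \in Lfun P 2%:E.
  move=> c0 mX cV; apply: Lfun2_of_variance => //.
  by rewrite ltey; apply: contraTN cV => /eqP ->; rewrite gt0_muley ?lte_fin.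
rewrite /cost; set s := (\sum_(k < N) _)%E.
have term0 (k : 'I_N) : (0 <= (q i k)%:E * 'V_P[x k] +
    (qbar i k * mean P (x k) ^+ 4)%:E + (r i k)%:E * 'V_P[ctl k] +
    (rbar i k * mean P (ctl k) ^+ 4)%:E)%E.
  by rewrite !adde_ge0 ?V0 ?m0 ?q0 ?qbar0 ?r0 ?rbar0// ltnW.
have s0 : (0 <= s)%E by exact: sume_ge0.
move=> Joo.
have soo (k : 'I_N) : ((q i k)%:E * 'V_P[x k] +
    (qbar i k * mean P (x k) ^+ 4)%:E + (r i k)%:E * 'V_P[ctl k] +
    (rbar i k * mean P (ctl k) ^+ 4)%:E < +oo)%E.
  apply: le_lt_trans Joo; apply: (@le_trans _ _ s).
    by rewrite /s (bigD1 k)//= leeDl// sume_ge0.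
  by rewrite leeDr// adde_ge0 ?V0 ?m0 ?q0 ?qbar0.
split=> k kN.
- have mx := state_measurable wp kN.
  move: kN mx; rewrite leq_eqVlt => /predU1P[->|kN] mx.
    apply: (L2 (q i N)) => //; first exact: q0.
    apply: le_lt_trans Joo; rewrite -addeA leeDl// adde_ge0//.
    by rewrite m0 ?qbar0.
  apply: (L2 (q i k)); rewrite ?q0 1?ltnW//.
  apply: le_lt_trans (soo (Ordinal kN)) => /=; rewrite -!addeA leeDl//.
  by rewrite !adde_ge0 ?V0 ?m0 ?qbar0 ?r0 ?rbar0// ltnW.
- have [mv _] := wp i kN.
  apply: (L2 (r i k)); rewrite ?r0//.
  apply: le_lt_trans (soo (Ordinal kN)) => /=.
  rewrite -addeA -[leLHS]add0e leeD// ?leeDl ?m0 ?rbar0//.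
  by rewrite adde_ge0 ?V0 ?m0 ?q0 ?qbar0// ltnW.
Qed.

End finite_cost.

(** * The equilibrium *)

Lemma expected_costE d (T : measurableType d) (R : realType)
    (P : probability T R) (n N : nat) (a : nat -> R)
    (b q qbar r rbar : 'I_n -> nat -> R) (x0 : T -> R) (eps : nat -> T -> R)
    (u : 'I_n -> feedback R) (i : 'I_n) :
  expected_cost P N a b q qbar r rbar x0 eps u i =
  cost P N a b q qbar r rbar x0 eps u i.
Proof.
rewrite /expected_cost; set C := cost _ _ _ _ _ _ _ _ _ _ _ _.
rewrite (integral_cst P measurableT C) [X in (_ * X)%E](_ : _ = 1%E) ?mule1//.
exact: probability_setT.
Qed.

Lemma borel_strategy (R : realType) (N : nat) (v : feedback R) :
  (forall k, (k < N)%N -> measurable_fun setT (v k)) -> strategy N v.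
Proof.
move=> mv k kN B mB; exists (v k @^-1` B).
  by rewrite -[X in measurable X]setTI; exact: (mv k kN measurableT B mB).
by exists set0; [exact: negligible_set0 | rewrite setU0].
Qed.

Lemma borel_well_posed d (T : measurableType d) (R : realType)
    (P : probability T R) (n N : nat) (a : nat -> R) (b : 'I_n -> nat -> R)
    (x0 : {RV P >-> R}) (eps : nat -> {RV P >-> R}) (u : 'I_n -> feedback R) :
  (forall i k, (k < N)%N -> measurable_fun setT (u i k)) ->
  well_posed P N a b x0 eps u.
Proof.
move=> mu.
have mg i k m : (k < N)%N -> measurable_fun setT (fun y => u i k (y, m)).
  by move=> kN; exact: measurableT_comp (mu i k kN) (measurable_pair2 m).
have mx k : (k <= N)%N -> measurable_fun setT (state P a b x0 eps u k).
  elim: k => [|k IH] kN //; have mx := IH (ltnW kN).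
  apply: measurable_funD => //; apply: measurable_funD.
    exact: measurable_funM.
  apply: measurable_sum => i; apply: measurable_funM => //.
  exact: measurableT_comp (mg i k _ kN) mx.
move=> i k kN; split.
  exact: measurableT_comp (mg i k _ kN) (mx k (ltnW kN)).
exists (fun y => u i k (y, mean P (state P a b x0 eps u k))).
by split; [exact: mg | exact: aeW].
Qed.

Lemma measurable_affine_feedback (R : realType) (n : nat) (a : nat -> R)
    (K Kbar : nat -> 'I_n -> R) (j : 'I_n) (k : nat) :
  measurable_fun setT (affine_feedback a K Kbar j k).
Proof.
apply: measurable_funB.
  by apply: measurable_funM => //; exact: measurable_funM.
by apply: measurable_funM => //; exact: measurable_funB.
Qed.

Lemma backward_ind (N : nat) (Q : nat -> Prop) :
  Q N -> (forall k, (k < N)%N -> Q k.+1 -> Q k) ->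
  forall k, (k <= N)%N -> Q k.
Proof.
move=> QN QS k kN; rewrite -(subKn kN).
elim: (N - k)%N (leq_subr k N) => [|m IH] mN.
  by rewrite subn0.
apply: QS; first by rewrite ltn_subrL (leq_trans _ mN).
by rewrite subnSK//; exact: IH (ltnW mN).
Qed.

Theorem proposition3 (R : realType) (d : measure_display) (T : measurableType d)
    (P : probability T R) (n N : nat) (hn : (2 <= n)%N) (hN : (1 <= N)%N)
    (a : nat -> R) (b q qbar r rbar : 'I_n -> nat -> R)
    (hq : forall (i : 'I_n) (k : nat), (k <= N)%N -> 0 < q i k)
    (hqbar : forall (i : 'I_n) (k : nat), (k <= N)%N -> 0 < qbar i k)
    (hr : forall (i : 'I_n) (k : nat), (k < N)%N -> 0 < r i k)
    (hrbar : forall (i : 'I_n) (k : nat), (k < N)%N -> 0 < rbar i k)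
    (eps : nat -> {RV P >-> R}) (x0 : {RV P >-> R})
    (heps0 : forall w : T, eps 0%N w = 0)
    (hepsmean : forall k : nat, ('E_P[eps k] = 0)%E)
    (hepspast : centered_given_past P eps)
    (hx0 : independent_of_noise P x0 eps)
    (alpha alphabar : 'I_n -> nat -> R)
    (c cbar : nat -> 'cV[R]_n)
    (hc : forall k : nat, (k < N)%N ->
       c k = cvec (r ^~ k) (alpha ^~ k.+1) (b ^~ k))
    (hcbar : forall k : nat, (k < N)%N ->
       cbar k = cbarvec (rbar ^~ k) (alphabar ^~ k.+1) (b ^~ k))
    (halphaN : forall i : 'I_n, alpha i N = q i N)
    (halphabarN : forall i : 'I_n, alphabar i N = qbar i N)
    (halphabar : forall (i : 'I_n) (k : nat), (k < N)%N ->
       alphabar i k =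
         qbar i k + rbar i k * (gain (cbar k) (b ^~ k) i * a k) ^+ 4
         + alphabar i k.+1 *
           (a k - \sum_(j < n) gain (cbar k) (b ^~ k) j * a k * b j k) ^+ 4)
    (halpha : forall (i : 'I_n) (k : nat), (k < N)%N ->
       alpha i k =
         q i k + r i k * (gain (c k) (b ^~ k) i * a k) ^+ 2
         + alpha i k.+1 *
           (a k - \sum_(j < n) gain (c k) (b ^~ k) j * a k * b j k) ^+ 2) :
  (forall k : nat, (k < N)%N ->
     (Emx (c k) (b ^~ k) \in unitmx) /\ (Emx (cbar k) (b ^~ k) \in unitmx)) /\
  feedback_nash P N a b q qbar r rbar x0 eps
    (fun (i : 'I_n) (k : nat) (z : R * R) =>
       - gain (cbar k) (b ^~ k) i * (a k * z.2)
       - gain (c k) (b ^~ k) i * a k * (z.1 - z.2)).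
Proof.
have alpha_gt0 i : forall k, (k <= N)%N -> 0 < alpha i k.
  apply: backward_ind => [|k kN IH]; first by rewrite halphaN hq.
  rewrite halpha// -addrA ltr_pwDl ?hq 1?ltnW// addr_ge0// mulr_ge0 ?sqr_ge0//.
    by rewrite ltW ?hr.
  exact: ltW.
have alphabar_gt0 i : forall k, (k <= N)%N -> 0 < alphabar i k.
  apply: backward_ind => [|k kN IH]; first by rewrite halphabarN hqbar.
  rewrite halphabar// -addrA ltr_pwDl ?hqbar 1?ltnW// addr_ge0// mulr_ge0//.
  - by rewrite ltW ?hrbar.
  - exact: exprn_even_ge0.
  - exact: ltW.
  - exact: exprn_even_ge0.
have unitE k : (k < N)%N ->
    (Emx (c k) (b ^~ k) \in unitmx) /\ (Emx (cbar k) (b ^~ k) \in unitmx).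
  move=> kN; split; apply: Emx_unitmx => i; rewrite ?hc ?hcbar//.
    by apply: cvec_mul_bounds; [exact: hr | exact: alpha_gt0].
  by apply: cbarvec_mul_bounds; [exact: hrbar | exact: alphabar_gt0].
split=> //.
pose K k j := gain (c k) (b ^~ k) j.
pose Kbar k j := gain (cbar k) (b ^~ k) j.
rewrite -/(affine_feedback a K Kbar).
have driftE F k i : a k - \sum_(j < n) F k j * a k * b j k =
    others_drift a b F i k - b i k * (F k i * a k).
  rewrite (bigD1 i)//= /others_drift mulrBr mulr1 mulr_sumr.
  rewrite (eq_bigr (fun j => a k * (F k j * b j k))); last by move=> j _; ring.
  by ring.
have K_stat i k : (k < N)%N ->
    (r i k + alpha i k.+1 * b i k ^+ 2) * (K k i * a k) =
    alpha i k.+1 * b i k * others_drift a b K i k.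
  move=> kN; have [uE _] := unitE k kN.
  have -> : K k i = c k i 0 * (1 - \sum_(j | j != i) K k j * b j k).
    exact: gain_best_response.
  rewrite hc// mxE /others_drift.
  field; rewrite gt_eqF// ltr_wpDr ?hr// mulr_ge0 ?sqr_ge0// ltW//.
  exact: alpha_gt0.
have alphaE i k : (k < N)%N -> alpha i k =
    q i k + (r i k * (K k i * a k) ^+ 2 + alpha i k.+1 *
      (others_drift a b K i k - b i k * (K k i * a k)) ^+ 2).
  by move=> kN; rewrite halpha// -driftE addrA.
have alphabarE i k : (k < N)%N -> alphabar i k - qbar i k =
    rbar i k * (Kbar k i * a k) ^+ 4 + alphabar i k.+1 *
      (others_drift a b Kbar i k - b i k * (Kbar k i * a k)) ^+ 4.
  by move=> kN; rewrite -driftE [in LHS]halphabar// /Kbar; ring.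
have mean_bound i k m z : (k < N)%N ->
    (alphabar i k - qbar i k) * m ^+ 4 <= rbar i k * z ^+ 4 +
      alphabar i k.+1 * (others_drift a b Kbar i k * m + b i k * z) ^+ 4.
  move=> kN; have [_ uE] := unitE k kN.
  have a0 := alphabar_gt0 i k.+1 kN.
  pose t := cbrt (alphabar i k.+1 * b i k / rbar i k).
  have tb0 : 0 <= t * b i k.
    apply: cbrt_mul_ge0; rewrite mulrAC -[_ * b i k * b i k]mulrA -expr2.
    by rewrite divr_ge0 ?(ltW (hrbar i k kN))// mulr_ge0 ?sqr_ge0// ltW.
  pose w := - (Kbar k i * a k) * m.
  have wE : w = - (t / (1 + t * b i k)) * (others_drift a b Kbar i k * m).
    have -> : t / (1 + t * b i k) = cbar k i 0 by rewrite hcbar// mxE.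
    rewrite /w /others_drift.
    have -> : Kbar k i = cbar k i 0 * (1 - \sum_(j | j != i) Kbar k j * b j k).
      exact: gain_best_response.
    by ring.
  apply: le_trans (quartic_best_response z (hrbar i k kN) a0 erefl tb0 wE).
  by rewrite alphabarE// /w le_eqVlt; apply/orP; left; apply/eqP; ring.
have mu i k : (k < N)%N -> measurable_fun setT (affine_feedback a K Kbar i k).
  by move=> _; exact: measurable_affine_feedback.
have wpu := borel_well_posed a b x0 eps mu.
set us := affine_feedback a K Kbar in wpu *.
split=> [i||i v _ wpv].
- by apply: borel_strategy => k; exact: mu.
- exact: wpu.
rewrite !expected_costE.
(* A deviation of infinite cost cannot be profitable. *)
have [Jv|] :=
  ltP (cost P N a b q qbar r rbar x0 eps (deviate us i v) i) +oo%E; last first.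
  by rewrite leye_eq => /eqP ->; rewrite leey.
have [x2 v2] := finite_cost_Lfun2 (hq i) (hqbar i) (hr i) (hrbar i) wpv Jv.
(* The noise is the next state minus a combination of square-integrable
   variables, so it inherits their integrability. *)
have eps2 k : (k < N)%N -> (eps k.+1 : T -> R) \in Lfun P 2%:E.
  move=> kN.
  apply: eq_Lfun2 (Lfun2_affine 1 (-1) 0 (x2 _ kN) (Lfun2_affine
    (others_drift a b K i k) (b i k) ((others_drift a b Kbar i k -
    others_drift a b K i k) * mean P _) (x2 _ (ltnW kN)) (v2 _ kN))) => w.
  rewrite mul1r mulN1r addr0; apply/eqP; rewrite eq_sym subr_eq; apply/eqP.
  by rewrite [RHS]addrC; exact: deviate_stateS.
have us_self : deviate us i (us i) = us.
  by apply/funext => j; rewrite /deviate; case: eqP => [->|].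
have x2' k : (k <= N)%N -> state P a b x0 eps us k \in Lfun P 2%:E.
  elim: k => [_|k IH kN]; first exact: (x2 0%N).
  have {}IH := IH (ltnW kN).
  apply: eq_Lfun2 (Lfun2_affine (a k - \sum_(j < n) K k j * a k * b j k) 1
    ((\sum_(j < n) (K k j - Kbar k j) * b j k) * a k *
      mean P (state P a b x0 eps us k)) IH (eps2 k kN)) => w.
  rewrite mul1r [LHS]/= -/(state P a b x0 eps us k).
  rewrite [RHS]addrAC; congr (_ + _).
  rewrite mulrBl !mulr_suml -addrA -sumrN -big_split/=; congr (_ + _).
  by apply: eq_bigr => j _; rewrite /us /affine_feedback/=; ring.
have ctl2' k : (k < N)%N -> control P a b x0 eps us i k \in Lfun P 2%:E.
  move=> kN; have X2 := x2' k (ltnW kN).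
  apply: eq_Lfun2 (Lfun2_affine (- (K k i * a k)) 0
    ((K k i * a k - Kbar k i * a k) * mean P (state P a b x0 eps us k)) X2 X2).
  by move=> w; rewrite /control /us /affine_feedback/=; ring.
have regret_ge0 k : (k < N)%N -> 0 <= regret a b qbar r rbar x0 eps K Kbar
    i v (alpha i) (alphabar i) k.
  move=> kN; rewrite /regret addr_ge0 ?subr_ge0 ?mean_bound// mulr_ge0//.
    rewrite addr_ge0 ?(ltW (hr i k kN))// mulr_ge0 ?sqr_ge0//.
    by rewrite ltW// alpha_gt0.
  by rewrite fine_ge0// variance_ge0.
have regret_eq0 k : (k < N)%N -> regret a b qbar r rbar x0 eps K Kbar
    i (us i) (alpha i) (alphabar i) k = 0.
  move=> kN; rewrite /regret us_self.
  have X2 := x2' k (ltnW kN).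
  set m := mean P (state P a b x0 eps us k).
  have ctlE : control P a b x0 eps us i k = (fun w => - (K k i * a k) *
      state P a b x0 eps us k w + 0 * state P a b x0 eps us k w +
      (K k i * a k - Kbar k i * a k) * m).
    by apply/funext => w; rewrite /control -/m /us /affine_feedback/=; ring.
  have -> : mean P (control P a b x0 eps us i k) = - (Kbar k i * a k) * m.
    by rewrite ctlE mean_affine ?Lfun2_Lfun1// -/m; ring.
  (* The prescribed control is [- K a x] up to a constant. *)
  have -> : (fun w => 1 * control P a b x0 eps us i k w +
      K k i * a k * state P a b x0 eps us k w + 0) =
      cst ((K k i * a k - Kbar k i * a k) * m).
    by apply/funext => w; rewrite ctlE /=; ring.
  by rewrite variance_cst alphabarE//=; ring.
rewrite (cost_regret rbar hepsmean hepspast hx0 wpv x2 v2 eps2 (halphaN i)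
  (halphabarN i) (K_stat i) (alphaE i)).
(* The profile itself is the deviation of agent [i] to its own strategy, so the
   same decomposition applies to both costs. *)
rewrite -{1}us_self.
rewrite (cost_regret rbar (v := us i) hepsmean hepspast hx0 _ _ _ eps2 (halphaN i)
  (halphabarN i) (K_stat i) (alphaE i)); rewrite ?us_self//.
rewrite lee_fin lerD2l; apply: ler_sum => k _.
by rewrite lerD2l regret_eq0// regret_ge0.
Qed.
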